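(* Let $t$ be an integer with $0\le t\le n-1$ and suppose that the nonempty subset $Y$ of $\mathrm{GL}(n,q)$ is a $t$-design and an $(n-t)$-code. Then the distance distribution $(A_i)_{0\le i\le n}$ of $Y$ satisfies \[ A_{n-i}=\sum_{j=i}^t(-1)^{j-i}q^{\binom{j-i}{2}}{j\brack i}_q{n\brack j}_q\left(\frac{|Y|}{\prod_{k=0}^{j-1}(q^n-q^k)}-1\right) \] for each $i\in\{0,1,\dots,n-1\}$.
   Context: $n\ge1$ and $q$ is a prime power. A $t$-design in $\mathrm{GL}(n,q)$ is a subset $Y$ that is transitive on $t$-tuples of linearly independent vectors of $\mathbb{F}_q^n$: there is a constant $r$ such that for any two linearly independent $t$-tuples $(v_i)$, $(v_i')$ exactly $r$ elements $g\in Y$ satisfy $gv_i=v_i'$ for all $i$ (for $t=0$ this is no condition). A $d$-code in $\mathrm{GL}(n,q)$ is a subset $Y$ such that for all distinct $x,y\in Y$ the element $x^{-1}y$ fixes no $(n-d+1)$-tuple of linearly independent elements of $\mathbb{F}_q^n$; equivalently $\operatorname{rk}(x-y)\ge d$ for all distinct $x,y\in Y$. The distance distribution of a nonempty $Y$ is $A_i=\frac1{|Y|}\,|\{(x,y)\in Y\times Y:\operatorname{rk}(x-y)=i\}|$, $0\le i\le n$. ${n\brack k}_q$ is the $q$-binomial coefficient, the number of $k$-dimensional subspaces of $\mathbb{F}_q^n$. Empty sums are $0$ and empty products are $1$. *)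

(* Defs.v *)
From HB Require Import structures.
From mathcomp Require Import all_boot all_order all_algebra all_fingroup.

Set Implicit Arguments.
Unset Strict Implicit.
Unset Printing Implicit Defensive.

Import GRing.Theory.
Local Open Scope ring_scope.

(* The prime power q is #|F| for a finite field F.  The carrier of             *)
(* {'GL_n[F]} consists of matrices of size n.-1.+1, which is n when 0 < n.     *)

Definition GL_tuple (F : finFieldType) (n t : nat) (g : {'GL_n[F]})
    (v : t.-tuple 'cV[F]_n.-1.+1) : t.-tuple 'cV[F]_n.-1.+1 :=
  map_tuple (mulmx (GLval g)) v.

Definition is_design (F : finFieldType) (n t : nat) (Y : {set {'GL_n[F]}}) :
    Prop :=
  exists r : nat, forall v w : t.-tuple 'cV[F]_n.-1.+1,
    free v -> free w -> #|[set g in Y | GL_tuple g v == w]| = r.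

(* n.+1 - d is n - d + 1 for d <= n; for d > n it is 0, and the empty tuple,   *)
(* which is free and always fixed, forces Y to have at most one element.       *)
Definition is_code (F : finFieldType) (n d : nat) (Y : {set {'GL_n[F]}}) :
    Prop :=
  forall x y : {'GL_n[F]}, x \in Y -> y \in Y -> x != y ->
  forall v : (n.+1 - d).-tuple 'cV[F]_n.-1.+1,
    free v -> GL_tuple (x^-1 * y)%g v <> v.

Definition distance_distr (F : finFieldType) (n : nat) (Y : {set {'GL_n[F]}})
    (i : nat) : rat :=
  #|[set p in setX Y Y | \rank (GLval p.1 - GLval p.2) == i]|%:R / #|Y|%:R.

(* Every subspace of F^n is the row space of some n x n matrix; distinct row   *)
(* spaces are counted once, as sets of vectors.                                *)
Definition subspaces (F : finFieldType) (n k : nat) : {set {set 'rV[F]_n}} :=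
  [set [set v : 'rV[F]_n | (v <= U)%MS] | U : 'M[F]_n & \rank U == k].

Definition qbinom (F : finFieldType) (n k : nat) : nat := #|subspaces F n k|.

(* Main.v *)
(** For [x] in [Y] and a free [j]-tuple [v] with [j <= t], the design property
gives the number of [y] in [Y] that agree with [x] on [v].  Counting the
triples [(x, y, v)] the other way round, through the free [j]-tuples of
[ker (x - y)], yields
  sum_k A_(n-k) [k choose j]_q = |Y| [n choose j]_q / prod_(l<j) (q^n - q^l).
The diagonal contributes [n choose j]_q, and by the code property only the
terms [k <= t] remain off the diagonal; Gaussian inversion of this triangular
system gives the formula. *)

Require Import Defs.
From mathcomp Require Import all_boot all_order all_algebra all_fingroup.
From mathcomp Require Import all_field all_character ring.

Set Implicit Arguments.
Unset Strict Implicit.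

Import Order.TTheory GRing.Theory Num.Theory.
Local Open Scope ring_scope.

(** * Gaussian binomial coefficients and their inversion *)

Section GaussianBinomials.
Variables (R : numFieldType) (q : R).
Hypothesis q_gt1 : 1 < q.

(* The number of free s-tuples in an m-dimensional space; 0 when m < s. *)
Definition qfall (m s : nat) : R := \prod_(0 <= k < s) (q ^+ m - q ^+ k).

(** The Gaussian binomial coefficient for a general [q]: for a prime power, free [s]-tuples divided
    by ordered bases of an [s]-space. [qbinomE] ties it to the count of subspaces. *)
Definition gauss (m s : nat) : R := qfall m s / qfall s s.

Lemma expq_neq0 m : q ^+ m != 0.
Proof. by rewrite expf_neq0 // gt_eqF // (lt_trans ltr01). Qed.

Lemma expqS_neq1 m : q ^+ m.+1 - 1 != 0.
Proof. by rewrite subr_eq0 gt_eqF // exprn_egt1. Qed.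

Lemma qfallS m s : qfall m s.+1 = qfall m s * (q ^+ m - q ^+ s).
Proof. by rewrite /qfall big_nat_recr. Qed.

(** The factor for [k = 0] is split off, and each of the other [s] factors is divisible by [q]. *)
Lemma qfallSS m s : qfall m.+1 s.+1 = (q ^+ m.+1 - 1) * q ^+ s * qfall m s.
Proof.
rewrite /qfall big_nat_recl // expr0 -mulrA; congr (_ * _).
rewrite -{2}[s]subn0 -prodr_const_nat -big_split /=.
by apply: eq_bigr => k _; rewrite !exprS; ring.
Qed.

Lemma qfall_small m s : (m < s)%N -> qfall m s = 0.
Proof.
elim: s m => // s IHs m; rewrite qfallS ltnS leq_eqVlt => /predU1P[-> | /IHs->].
  by rewrite subrr mulr0.
by rewrite mul0r.
Qed.

Lemma qfall_neq0 m s : (s <= m)%N -> qfall m s != 0.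
Proof.
elim: s m => [|s IHs] m; first by rewrite /qfall big_geq ?oner_eq0.
by case: m => // m le_sm; rewrite qfallSS !mulf_neq0 ?expqS_neq1 ?expq_neq0 ?IHs.
Qed.

Lemma gauss0 m : gauss m 0 = 1.
Proof. by rewrite /gauss /qfall !big_geq // divr1. Qed.

Lemma gaussnn m : gauss m m = 1.
Proof. by rewrite /gauss divff ?qfall_neq0. Qed.

Lemma gauss_small m s : (m < s)%N -> gauss m s = 0.
Proof. by move=> lt_ms; rewrite /gauss qfall_small // mul0r. Qed.

Lemma gauss_absorb m s :
  gauss m.+1 s.+1 = gauss m s * ((q ^+ m.+1 - 1) / (q ^+ s.+1 - 1)).
Proof.
rewrite /gauss !qfallSS; field.
by rewrite expq_neq0 expqS_neq1 qfall_neq0.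
Qed.

Lemma gauss_pascal m s :
  gauss m.+1 s.+1 = q ^+ s.+1 * gauss m s.+1 + gauss m s.
Proof.
rewrite /gauss !qfallSS qfallS.
have := expqS_neq1 s; have := expq_neq0 s; have := qfall_neq0 (leqnn s).
by rewrite !exprS => *; field; apply/and3P.
Qed.

(** By [gauss_absorb], raising [m], [j] and [i] together by one multiplies both sides by the same
    quotient, while [m - i] and [j - i] stay fixed. *)
Lemma gauss_trinomial m j i : (i <= j <= m)%N ->
  gauss m j * gauss j i = gauss m i * gauss (m - i) (j - i).
Proof.
elim: i j m => [|i IHi] j m; first by rewrite !gauss0 !subn0 mulr1 mul1r.
case: j => // j; case: m => [|m]; first by rewrite andbF.
rewrite !ltnS !subSS => le_ijm; rewrite !gauss_absorb mulrACA IHi //.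
by field; rewrite !expqS_neq1.
Qed.

(** For [m > 0] the [q]-Pascal rule makes the sum telescope. Any bound [M > m] is allowed, so that
    one range of summation can serve several [m]. *)
Lemma sum_gauss_alt m M : (m < M)%N ->
  \sum_(0 <= s < M) (-1) ^+ s * q ^+ 'C(s, 2) * gauss m s = (m == 0)%:R.
Proof.
case: m => [|m] lt_mM.
  rewrite big_ltn // gauss0 bin0n !expr0 !mulr1 big1_seq ?addr0 // => -[|s] //.
    by rewrite mem_index_iota.
  by rewrite gauss_small // mulr0.
pose u s := (-1) ^+ s * q ^+ 'C(s.+1, 2) * gauss m s.
case: M lt_mM => // M lt_mM; rewrite big_ltn // big_add1 /=.
rewrite (eq_bigr (fun s => u s.+1 - u s)) => [|s _]; last first.
  by rewrite gauss_pascal /u (binS s.+1) bin1 exprD (exprS (-1)); ring.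
(* The upper end vanishes because [m < M], and [- u 0 = -1] cancels the term [s = 0] split off
   before. *)
rewrite telescope_sumr // /u !gauss0 gauss_small // bin_small //.
by rewrite !expr0; ring.
Qed.

(** After exchanging the sums, [gauss_trinomial] turns the coefficient of [a k] into [gauss k i]
    times an alternating sum, which vanishes unless [k = i]. *)
Lemma gauss_inversion (t i : nat) (a : nat -> R) : (i <= t)%N ->
  \sum_(i <= j < t.+1) (-1) ^+ (j - i) * q ^+ 'C(j - i, 2) * gauss j i *
     (\sum_(0 <= k < t.+1) a k * gauss k j) = a i.
Proof.
move=> le_it.
under eq_bigr do rewrite mulr_sumr.
rewrite exchange_big /= (big_cat_nat (n := i)) //= 1?ltnW //.
rewrite big_nat big1 => [|k /andP[_ lt_ki]]; last first.
  rewrite big_nat big1 // => j /andP[le_ij _].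
  by rewrite (@gauss_small k j) ?(leq_trans lt_ki) // !mulr0.
rewrite add0r big_nat (eq_bigr (fun k => a k * gauss k i * (k == i)%:R)).
  rewrite -big_nat big_ltn // eqxx gaussnn !mulr1 big_nat big1 ?addr0 //.
  by move=> k /andP[lt_ik _]; rewrite gtn_eqF //= mulr0.
move=> k /andP[le_ik lt_kt].
have -> : (k == i) = (k - i == 0)%N by rewrite subn_eq0 eqn_leq le_ik andbT.
rewrite -(@sum_gauss_alt (k - i) (t.+1 - i)) ?ltn_sub2r //.
rewrite mulr_sumr -{1}[i]add0n big_addn; apply: eq_bigr => s _.
(* With [j = s + i], the terms with [j > k] are zero on both sides, so the trinomial identity is
   needed only for [j <= k]. *)
rewrite addnK; have [le_sk | lt_ks] := leqP (s + i) k; last first.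
  by rewrite !(@gauss_small _ (_ + _)) ?(@gauss_small _ s) ?ltn_subLR ?mulr0 // addnC.
have:= @gauss_trinomial k (s + i) i; rewrite leq_addl le_sk addnK => /(_ isT) E.
set c := _ ^+ s * _; transitivity (c * a k * (gauss k (s + i) * gauss (s + i) i)).
  by ring.
by rewrite E; ring.
Qed.

End GaussianBinomials.

(** * Counting free tuples *)

(** [P] is a predicate on sequences so that the same [P] applies to tuples of different lengths. *)
Lemma card_tupleS (T : finType) (j : nat) (P : pred (seq T)) :
  #|[set w : j.+1.-tuple T | P w]| =
    (\sum_(v : j.-tuple T) #|[set x | P (x :: v)]|)%N.
Proof.
rewrite -sum1dep_card; under [RHS]eq_bigr do rewrite -sum1dep_card.
rewrite (pair_big_dep predT (fun v x => P (x :: tval v))) /=.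
rewrite (reindex (fun p : j.-tuple T * T => cons_tuple p.2 p.1)) //=.
exists (fun w => (behead_tuple w, thead w)) => [[v x] _ | w _] /=.
  by congr (_, _); apply: val_inj.
by rewrite [w in RHS]tuple_eta; apply: val_inj.
Qed.

Section CountingFreeTuples.
Variables (F : finFieldType) (a b : nat).
Implicit Types U : {vspace 'M[F]_(a, b)}.
Local Notation q := (#|F|%:R : rat).

Lemma card_field_gt1 : 1 < q.
Proof. by rewrite ltr1n finNzRing_gt1. Qed.

(** A free [j]-tuple in [U] extends by exactly the vectors of [U] outside its span, which number
    [q ^ \dim U - q ^ j]. For [j > \dim U] both sides are zero. *)
Lemma card_free_tuples U j :
  #|[set v : j.-tuple 'M[F]_(a, b) | free v && (<<v>> <= U)%VS]|%:R
    = qfall q (\dim U) j.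
Proof.
elim: j => [|j IHj].
  rewrite /qfall big_geq // (_ : [set _ | _] = setT) ?cardsT ?card_tuple //.
  by apply/setP=> v; rewrite tuple0 !inE nil_free span_nil sub0v.
pose P (s : seq 'M[F]_(a, b)) := free s && (<<s>> <= U)%VS.
rewrite (card_tupleS _ P) qfallS -IHj -sum1dep_card !natr_sum mulr_suml.
rewrite [RHS]big_mkcond /=; apply: eq_bigr => v _; rewrite mul1r.
rewrite /P; case: ifP => [/andP[fv svU] | Pv]; last first.
  rewrite -[RHS](mulr0n 1) -(cards0 'M[F]_(a, b)); congr _%:R; apply: eq_card => x.
  rewrite !inE free_cons span_cons subv_add -memvE.
  by rewrite andbACA Pv andbF.
have -> : [set x | free (x :: v) && (<<x :: v>> <= U)%VS]
    = [set x in U] :\: [set x in <<v>>%VS].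
  apply/setP=> x; rewrite !inE free_cons span_cons subv_add -memvE fv svU.
  by rewrite !andbT.
have sub : [set x in <<v>>%VS] \subset [set x in U].
  by apply/subsetP=> x; rewrite !inE; apply: subvP.
rewrite cardsD (setIidPr sub) natrB ?subset_leq_card // !cardsE !card_vspace !natrX.
by move: fv; rewrite /free size_tuple => /eqP->.
Qed.

Lemma exists_free_tuple U j : (j <= \dim U)%N ->
  exists v : j.-tuple 'M[F]_(a, b), free v && (<<v>> <= U)%VS.
Proof.
move=> le_jd; suff /set0Pn[v] : [set v : j.-tuple 'M[F]_(a, b)
    | free v && (<<v>> <= U)%VS] != set0 by rewrite inE; exists v.
rewrite -card_gt0 lt0n -(pnatr_eq0 rat) card_free_tuples.
by rewrite qfall_neq0 // card_field_gt1.
Qed.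

Lemma card_free_tuplesT j :
  #|[set v : j.-tuple 'M[F]_(a, b) | free v]|%:R = qfall q (a * b) j.
Proof.
have := card_free_tuples fullv j; rewrite dimvf /dim /= => <-.
by congr _%:R; apply: eq_card => v; rewrite !inE subvf andbT.
Qed.

End CountingFreeTuples.

(** * Kernels, and subspaces as counted by [qbinom] *)

(** Dimensions are compared through cardinalities: transposition maps this kernel bijectively onto
    the row kernel of the transpose of [A]. *)
Lemma dim_ker_mulmx (F : finFieldType) (m n : nat) (A : 'M[F]_(m, n)) :
  \dim (lker (linfun (mulmx A : 'cV_n -> 'cV_m))) = (n - \rank A)%N.
Proof.
apply: (expnI (finNzRing_gt1 F)); rewrite -card_vspace -(mxrank_tr A) -mxrank_ker.
rewrite -card_rowg; set K := lker _; rewrite -(card_imset [in K] (@trmx_inj _ _ _)).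
apply: eq_card => v; rewrite -[v]trmxK (mem_imset _ _ (@trmx_inj _ _ _)).
rewrite -topredE /= memv_ker lfunE /= inE sub_kermx -trmx_mul.
by rewrite -[in LHS](inj_eq (@trmx_inj _ _ _)) trmx0.
Qed.

Lemma span_rows (F : fieldType) (n k : nat) (v : k.-tuple 'rV[F]_n) (x : 'rV_n) :
  (x \in <<v>>%VS) = (x <= \matrix_(i < k) tnth v i)%MS.
Proof.
apply/idP/submxP => [/coord_span-> | [c ->]].
  exists (\row_i coord v i x); rewrite mulmx_sum_row; apply: eq_bigr => i _.
  by rewrite mxE rowK -tnth_nth.
rewrite mulmx_sum_row rpred_sum // => i _.
by rewrite rowK rpredZ // memv_span // mem_tnth.
Qed.

Lemma span_subspaces (F : finFieldType) (n k : nat) (v : k.-tuple 'rV[F]_n) :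
  free v -> [set x in <<v>>%VS] \in subspaces F n k.
Proof.
rewrite /free size_tuple => /eqP dv; set A := (\matrix_(i < k) tnth v i).
have E : [set x in <<v>>%VS] = [set x | (x <= <<A>>)%MS].
  by apply/setP=> x; rewrite !inE span_rows genmxE.
rewrite E; apply: imset_f; rewrite inE -(eqn_exp2l _ _ (finNzRing_gt1 F)).
by rewrite -card_rowg /rowg -E cardsE card_vspace dv.
Qed.

Lemma subspacesP (F : finFieldType) (n k : nat) (S : {set 'rV[F]_n}) :
  S \in subspaces F n k ->
  exists2 U : {vspace 'rV[F]_n}, \dim U = k & S = [set x in U].
Proof.
case/imsetP=> A /[!inE] /eqP rA ->{S}.
pose v := [tuple row i (row_base A) | i < \rank A].
have Ev x : (x \in <<v>>%VS) = (x <= A)%MS.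
  rewrite span_rows (_ : \matrix_i tnth v i = row_base A) ?eq_row_base //.
  by apply/row_matrixP=> i; rewrite rowK tnth_mktuple.
exists <<v>>%VS; last by apply/setP=> x; rewrite !inE Ev.
apply: (expnI (finNzRing_gt1 F)); rewrite -card_vspace -rA -card_rowg.
by apply: eq_card => x; rewrite Ev inE.
Qed.

(** The free [k]-tuples of the whole space are grouped by their span; each [k]-dimensional subspace
    arises from [qfall k k] of them, its ordered bases. *)
Lemma qbinomE (F : finFieldType) (n k : nat) :
  (qbinom F n k)%:R = gauss (#|F|%:R : rat) n k.
Proof.
apply: (canRL (mulfK _)); first by rewrite qfall_neq0 // card_field_gt1.
have := card_free_tuplesT F 1 n k; rewrite mul1n => <-.
pose span_set (v : k.-tuple 'rV[F]_n) := [set x in <<v>>%VS].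
rewrite -(sum1dep_card (fun v : k.-tuple 'rV[F]_n => free v)).
rewrite (partition_big span_set [in subspaces F n k]) /=; last first.
  by move=> v; apply: span_subspaces.
rewrite natr_sum (eq_bigr (fun=> qfall (#|F|%:R : rat) k k)) => [|S].
  by rewrite sumr_const mulr_natl.
case/subspacesP=> U dU ->; transitivity (qfall (#|F|%:R : rat) (\dim U) k).
  rewrite -card_free_tuples sum1dep_card.
  congr _%:R; apply: eq_card => v; rewrite !inE.
  case fv: (free v) => //=; move: (fv); rewrite /free size_tuple => /eqP dv.
  have <- : (<<v>>%VS == U) = (<<v>> <= U)%VS by rewrite eqEdim dv dU leqnn andbT.
  rewrite /span_set; apply/eqP/eqP => [/setP E | ->] //; apply/vspaceP=> x.
  by have := E x; rewrite !inE.
by rewrite dU.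
Qed.

(** * Consequences of the design and code properties *)

Section Designs.
Variables (F : finFieldType) (n : nat) (Y : {set {'GL_n[F]}}).
Local Notation q := (#|F|%:R : rat).
Local Notation N := n.-1.+1.

Lemma free_mulGL (g : {'GL_n[F]}) (s : seq 'cV[F]_N) :
  free (map (mulmx (GLval g)) s) = free s.
Proof.
pose f := linfun (mulmx (GLval g) : 'cV_N -> 'cV_N).
have kf : lker f == 0%VS.
  by apply/lker0P=> x y; rewrite !lfunE /= => /(can_inj (mulKmx (GL_unitmx g))).
have -> : map (mulmx (GLval g)) s = map f s by apply: eq_map => x; rewrite lfunE.
by rewrite /free size_map -limg_span limg_dim_eq // (eqP kf) capv0.
Qed.

(** Extend [v] by some [x] outside its span and sort the elements [g] by the image of [x]. Each
    image outside the span of [w] is taken by [r] elements, which explains the new constant. *)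
Lemma design_pred t : (t < N)%N -> is_design t.+1 Y -> is_design t Y.
Proof.
move=> lt_tN [r Yr]; exists (r * (#|F| ^ N - #|F| ^ t))%N => v w fv fw.
have cardT : #|{: 'cV[F]_N}| = (#|F| ^ N)%N by rewrite card_mx muln1.
have card_span (u : t.-tuple 'cV[F]_N) : free u ->
    #|[set x | x \notin <<u>>%VS]| = (#|F| ^ N - #|F| ^ t)%N.
  rewrite /free size_tuple => /eqP du.
  rewrite (_ : [set _ | _] = ~: [set x in <<u>>%VS]).
    by rewrite cardsCs setCK cardT cardsE card_vspace du.
  by apply/setP=> x; rewrite !inE.
have [x vx] : exists x, x \notin <<v>>%VS.
  suff /set0Pn[x] : [set x | x \notin <<v>>%VS] != set0 by rewrite inE; exists x.
  by rewrite -card_gt0 card_span // subn_gt0 ltn_exp2l ?finNzRing_gt1.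
rewrite -sum1_card (partition_big (fun g => GLval g *m x) predT) //=.
(* An image inside the span of [w] is impossible, since [g] preserves freeness. *)
rewrite (bigID [pred y | y \in <<w>>%VS]) /= big1 => [|y wy]; last first.
  rewrite big1 // => g /andP[/[!inE] /andP[Yg /eqP gv] /eqP gx].
  have := free_mulGL g (x :: v); rewrite /= -[map _ v]/(tval (GL_tuple g v)).
  by rewrite gv gx !free_cons wy vx fv.
rewrite add0n (eq_bigr (fun=> r)) => [|y wy].
  by rewrite sum_nat_const mulnC; congr (_ * _)%N; rewrite -(card_span w fw) cardsE.
rewrite sum1dep_card -(Yr (cons_tuple x v) (cons_tuple y w)); first last.
- by rewrite free_cons wy.
- by rewrite free_cons vx.
apply: eq_card => g; rewrite !inE -andbA; congr (_ && _).
by rewrite -!val_eqE /= eqseq_cons andbC.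
Qed.

Lemma design_le s t : (s <= t <= N)%N -> is_design t Y -> is_design s Y.
Proof.
elim: t => [|t IHt]; first by rewrite leqn0 andbC => /andP[_ /eqP->].
case/andP; rewrite leq_eqVlt => /predU1P[-> // | le_st lt_tN] Yt.
by apply: IHt; [rewrite -ltnS le_st ltnW | apply: design_pred].
Qed.

(** Every element of [Y] sends [v] to exactly one free tuple, and there are [qfall q N t] of these,
    each hit equally often. *)
Lemma design_count (t : nat) (v w : t.-tuple 'cV[F]_N) :
    (t <= N)%N -> is_design t Y -> free v -> free w ->
  #|[set g in Y | GL_tuple g v == w]|%:R = #|Y|%:R / qfall q N t.
Proof.
move=> le_tN [r Yr] fv fw; rewrite Yr //.
apply: (canRL (mulfK _)); first by rewrite qfall_neq0 // card_field_gt1.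
have := card_free_tuplesT F N 1 t; rewrite muln1 => <-; rewrite -natrM.
congr _%:R; rewrite -[RHS]sum1_card.
rewrite (partition_big (fun g => GL_tuple g v) (fun u => free u)) /=; last first.
  by move=> g _; rewrite free_mulGL.
rewrite (eq_bigr (fun=> r)) => [|u fu]; last first.
  by rewrite sum1dep_card -(Yr v u fv fu).
by rewrite sum_nat_const mulnC cardsE.
Qed.

Lemma design_moment t : (t <= N)%N -> is_design t Y ->
  \sum_(p in setX Y Y) qfall q (N - \rank (GLval p.1 - GLval p.2)) t
    = #|Y|%:R ^+ 2.
Proof.
move=> le_tN Yt.
pose K (p : {'GL_n[F]} * {'GL_n[F]}) := lker (linfun (mulmx (GLval p.1 - GLval p.2)
   : 'cV[F]_N -> 'cV[F]_N)).
have KE p (v : t.-tuple 'cV[F]_N) :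
    (<<v>> <= K p)%VS = (GL_tuple p.2 v == GL_tuple p.1 v).
  apply/span_subvP/eqP => [Kv | E x vx].
    apply: eq_from_tnth => i; rewrite !tnth_map; apply/eqP.
    have := Kv _ (mem_tnth i v); rewrite memv_ker lfunE /= mulmxBl subr_eq0.
    by rewrite eq_sym.
  case/tnthP: vx => i ->; rewrite memv_ker lfunE /= mulmxBl subr_eq0.
  by have := congr1 (fun u : t.-tuple _ => tnth u i) E; rewrite !tnth_map => ->.
rewrite (eq_bigl (fun p => (p.1 \in Y) && (p.2 \in Y))) => [|p]; last by rewrite inE.
rewrite -(pair_big [in Y] [in Y]
  (fun x y => qfall q (N - \rank (GLval x - GLval y)) t)) /=.
(* The right side becomes [#|Y|] summed over [x] in [Y], so it suffices to treat each [x]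
   separately. *)
rewrite expr2 mulr_natl -(sumr_const [in Y] #|Y|%:R); apply: eq_bigr => x Yx.
transitivity (\sum_(y in Y) (\sum_(v : t.-tuple 'cV[F]_N
    | free v && (GL_tuple y v == GL_tuple x v)) 1)%N%:R : rat).
  apply: eq_bigr => y _; rewrite -dim_ker_mulmx -/(K (x, y)) -card_free_tuples.
  by rewrite -sum1dep_card; under eq_bigl do rewrite KE.
rewrite -natr_sum (exchange_big_dep (fun v : t.-tuple 'cV[F]_N => free v)) /=; last first.
  by move=> y v _ /andP[].
(* For fixed [x] and [v], the elements [y] with [y v = x v] are counted by [design_count] with
   target [x v]. *)
rewrite natr_sum (eq_bigr (fun=> #|Y|%:R / qfall q N t)) => [|v fv]; last first.
  rewrite -(@design_count _ v (GL_tuple x v)) ?free_mulGL // -sum1dep_card.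
  by under eq_bigl do rewrite fv.
rewrite sumr_const -[LHS]mulr_natl [X in X * _](_ : _ = qfall q N t); last first.
  have := card_free_tuplesT F N 1 t; rewrite muln1 => <-.
  by congr _%:R; apply: eq_card => v; rewrite inE.
by rewrite mulrC divfK // qfall_neq0 // card_field_gt1.
Qed.

(** A larger kernel of [x - y] would contain a free tuple of length [n.+1 - d], and [x^-1 * y] fixes
    every vector of that kernel. *)
Lemma code_rank d (x y : {'GL_n[F]}) : is_code d Y -> x \in Y -> y \in Y ->
  x != y -> (N - \rank (GLval x - GLval y)%R < n.+1 - d)%N.
Proof.
move=> Yd Yx Yy neq_xy; rewrite ltnNge; apply/negP.
rewrite -dim_ker_mulmx => /exists_free_tuple[v /andP[fv /span_subvP vK]].
have [] := Yd x y Yx Yy neq_xy v fv.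
apply: eq_from_tnth => i; rewrite tnth_map.
have := vK _ (mem_tnth i v); rewrite memv_ker lfunE /= mulmxBl subr_eq0.
move=> /eqP xy_v; transitivity ((invmx (GLval x) *m GLval y) *m tnth v i) => //.
by rewrite -mulmxA -xy_v mulKmx // GL_unitmx.
Qed.

End Designs.

(** * The distance distribution *)

Unset Implicit Arguments.

Theorem theorem7p6 (F : finFieldType) (n t : nat) (Y : {set {'GL_n[F]}})
    (n_gt0 : (0 < n)%N) (t_le : (t <= n - 1)%N) (Y_neq0 : Y != set0)
    (Y_design : is_design t Y) (Y_code : is_code (n - t) Y) :
  forall i : nat, (i < n)%N ->
    distance_distr Y (n - i) =
      \sum_(i <= j < t.+1)
        (-1) ^+ (j - i) * #|F|%:R ^+ 'C(j - i, 2)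
        * (qbinom F j i)%:R * (qbinom F n j)%:R
        * (#|Y|%:R / (\prod_(0 <= k < j) (#|F|%:R ^+ n - #|F|%:R ^+ k)) - 1).
Proof.
move=> i lt_in.
have lt_tn : (t < n)%N by rewrite -(prednK n_gt0) ltnS -subn1.
have nN : n.-1.+1 = n by rewrite prednK.
have q_gt1 := card_field_gt1 F.
pose q : rat := #|F|%:R.
have Y0 : #|Y|%:R != 0 :> rat by rewrite pnatr_eq0 -lt0n card_gt0.
pose rk (p : {'GL_n[F]} * {'GL_n[F]}) := \rank (GLval p.1 - GLval p.2).
have rk_le p : (rk p <= n)%N by apply: leq_trans (rank_leq_row _) _; rewrite nN.
(* For [d = n - t] the forbidden tuple length is [t + 1], so the kernel of [x - y] has dimension at
   most [t]. *)
have rk_off x y : x \in Y -> y \in Y -> x != y -> (n - rk (x, y) <= t)%N.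
  move=> Yx Yy neq_xy; have := code_rank Y_code Yx Yy neq_xy.
  by rewrite -/(rk (x, y)) nN subSn ?leq_subr // subKn ?(ltnW lt_tn) // ltnS.
(* A diagonal pair has the whole space as kernel and so contributes [qfall q n j] to the moment. *)
have offdiag j : (j <= t)%N ->
    \sum_(p in setX Y Y | p.1 != p.2) qfall q (n - rk p) j
      = #|Y|%:R ^+ 2 - #|Y|%:R * qfall q n j.
  move=> le_jt; have le_jN : (j <= n.-1.+1)%N by rewrite nN (leq_trans le_jt) 1?ltnW.
  have Yj : is_design j Y by apply: design_le Y_design; rewrite le_jt nN ltnW.
  have := design_moment le_jN Yj; rewrite (bigID (fun p => p.1 == p.2)) /= => <-.
  rewrite [X in X + _ - _](_ : _ = #|Y|%:R * qfall q n j); last first.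
    rewrite (eq_bigr (fun=> qfall q n j)) => [|p /andP[_ /eqP->]]; last first.
      by rewrite subrr mxrank0 subn0 nN.
    rewrite sumr_const mulr_natl; congr (_ *+ _).
    rewrite -(card_imset [in Y] (f := fun x => (x, x))); last by move=> x y [].
    apply: eq_card => -[x y]; rewrite unfold_in /= in_setX /=; apply/idP/imsetP => /=.
      by case/andP=> /andP[Yx _] /eqP <-; exists x.
    by case=> z Yz [-> ->]; rewrite !(Yz : z \in Y) eqxx.
  by rewrite [X in X - _]addrC addrK; apply: eq_bigr => p _; rewrite -/(rk p) nN.
(* Only off-diagonal pairs are counted, by kernel dimension [k]. As diagonal pairs have kernel
   dimension [n], this agrees with the distance distribution for [k < n]. *)
pose A k := #|[set p in setX Y Y | (p.1 != p.2) && (n - rk p == k)%N]|%:R / #|Y|%:R : rat.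
have AE k : (k < n)%N -> distance_distr Y (n - k) = A k.
  move=> lt_kn; congr (_%:R / _); apply: eq_card => -[x y]; rewrite !inE /=.
  congr (_ && _); rewrite -/(rk (x, y)).
  have -> : (rk (x, y) == n - k)%N = (n - rk (x, y) == k)%N.
    by apply/eqP/eqP=> [->|<-]; rewrite subKn // ltnW.
  case: (n - rk (x, y) =P k)%N => rk_k; rewrite ?andbF // andbT; apply/esym/eqP=> exy.
  by move: lt_kn; rewrite -rk_k exy /rk /= subrr mxrank0 subn0 ltnn.
have A_moment j : (j <= t)%N ->
    \sum_(0 <= k < t.+1) A k * gauss q k j
      = gauss q n j * (#|Y|%:R / qfall q n j - 1).
  move=> le_jt.
  have -> : \sum_(0 <= k < t.+1) A k * gauss q k j
      = (\sum_(p in setX Y Y | p.1 != p.2) qfall q (n - rk p) j)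
          / (#|Y|%:R * qfall q j j).
    (* By [rk_off], [inord] never falls back on its default value on these pairs. *)
    rewrite big_mkord (partition_big (fun p => inord (n - rk p) : 'I_t.+1) xpredT) //=.
    rewrite mulr_suml; apply: eq_bigr => k _.
    rewrite (eq_bigr (fun=> qfall q k j)) => [|[x y]]; last first.
      rewrite !inE /= => /andP[/andP[/andP[Yx Yy] neq_xy] /eqP <-].
      by rewrite inordK // ltnS rk_off.
    rewrite sumr_const /A /gauss -[X in _ = X / _]mulr_natl invfM [RHS]mulrACA.
    congr (_%:R / _ * _); apply: eq_card => -[x y]; rewrite [RHS]unfold_in !inE /= -andbA.
    case: (boolP (x \in Y)) => //= Yx; case: (boolP (y \in Y)) => //= Yy.
    case: (boolP (x != y)) => //= neq_xy.
    have le_rk : (n - rk (x, y) < t.+1)%N by rewrite ltnS rk_off.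
    apply/eqP/eqP => [E | <-]; last by rewrite inordK.
    by apply: val_inj; rewrite /= inordK.
  rewrite offdiag // /gauss; field.
  by rewrite Y0 !qfall_neq0 // (leq_trans le_jt) // ltnW.
(* If [t < i], the sum is empty and no off-diagonal pair has kernel dimension [i]; otherwise the
   inversion applies. *)
have [lt_ti | le_it] := ltnP t i.
  rewrite big_geq // AE // /A (_ : [set _ in _ | _] = set0) ?cards0 ?mul0r //.
  apply/setP=> -[x y]; rewrite !inE; apply/negP => /andP[/andP[Yx Yy] /andP[neq_xy /eqP E]].
  by have := rk_off x y Yx Yy neq_xy; rewrite E leqNgt lt_ti.
rewrite AE // -(gauss_inversion q_gt1 A le_it).
rewrite !big_nat; apply: eq_bigr => j /andP[le_ij lt_jt].
by rewrite A_moment // !qbinomE mulrA.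
Qed.
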